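(* Let $\mathbb D^{tot}_{JL}=\mathbb D^{\Omega}_{IK}(C_{IJKL})+\mathbb S_{JL}$ be the total discrete elastic operator, where $\mathbb S_{JL}$ is given either by the penalty terms (SATs) for homogeneous Robin boundary conditions, $$\mathbb S_{JL}\mathbf u_L=-(\mathcal JH)^{-1}\sum_{f\in\mathcal F}e_f\,\hat J\,H_f\,e_f^T\left(\mathbb T_{JL}\mathbf u_L+U_{JL}\mathbf u_L\right),$$ or by the SATs for homogeneous displacement boundary conditions, $$\mathbb S_{JL}\mathbf u_L=(\mathcal JH)^{-1}\sum_{f\in\mathcal F}\left(\mathbb T_{LJ}-\mathbb Z_{LJ}\right)^Te_f\,\hat J\,H_f\,e_f^T\mathbf u_L,\qquad \mathbb Z_{JL}=\beta\frac{d\,\hat J}{h_1\mathcal J}n_IC_{IJKL}n_K,\quad \beta\ge1.$$ In both cases the total discrete elastic operator is self-adjoint, i.e. $$(\boldsymbol\phi_J,\mathbb D^{tot}_{JL}\mathbf u_L)_\Omega=(\mathbb D^{tot}_{JL}\boldsymbol\phi_L,\mathbf u_J)_\Omega\qquad\text{for all grid vectors }\boldsymbol\phi_J,\mathbf u_J .$$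
   Context: Conventions. Repeated subscripts $i,j,k,\ell,I,J,K,L$ are summed from $1$ to $d$, also inside bilinear forms, except where ''no sum'' is stated. Boldface symbols are real grid vectors. A spatially variable coefficient is identified with the diagonal matrix of its grid values. The physical domain $\Omega\subset\mathbb R^d$ is the image of the reference cube $\omega=[0,1]^d$ (coordinates $x_i$) under a smooth one-to-one map $X_I=X_I(x_1,\dots,x_d)$. One-dimensional operators. On a grid of $[0,1]$ including both end points, $H_x=\mathrm{diag}(h_1,h_2,\dots,h_2,h_1)$ has positive diagonal entries (proportional to the grid spacing $h$); $e_0=(1,0,\dots,0)^T$, $e_N=(0,\dots,0,1)^T$. The first-derivative summation-by-parts (SBP) operator $D_x\approx\partial_x$ satisfies $H_xD_x=-D_x^TH_x-e_0e_0^T+e_Ne_N^T$. The fully compatible second-derivative SBP operator $D^{FC}_{xx}(b)\approx\partial_x b\,\partial_x$ satisfies $$H_xD^{FC}_{xx}(b)=-D_x^TH_xbD_x-R_{xx}(b)-e_0e_0^TbD_x+e_Ne_N^TbD_x,$$ where $R_{xx}(b)=\sum_\alpha\mathcal D_{x^\alpha}^TB_\alpha(b)\mathcal D_{x^\alpha}$, the matrices $\mathcal D_{x^\alpha}$ do not depend on $b$, and $B_\alpha(b)$ is diagonal with entries $(B_\alpha(b))_r=\sum_s\beta_{\alpha,r,s}b_s$, $\beta_{\alpha,r,s}\ge0$, $b_s$ being the value of $b$ at grid point $s$. The same grid spacing (hence the same $h_1$) is used in each coordinate direction. Multi-dimensional operators on $\omega$. $D_i=I\otimes\cdots\otimes D_{x_i}\otimes\cdots\otimes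 I$ (with $D_{x_i}$ in position $i$); $D^{FC}_{ii}(b)$ (no sum) applies $D^{FC}_{xx}(b)$ along each grid line in direction $i$; $\mathbb D_{ij}(b)=D^{FC}_{ii}(b)$ if $i=j$ and $\mathbb D_{ij}(b)=D_i\,b\,D_j$ if $i\ne j$. $H=H_{x_1}\otimes\cdots\otimes H_{x_d}$. The faces of $\omega$ are $\partial\omega_i^-=\{x_i=0\}$, $\partial\omega_i^+=\{x_i=1\}$; $\mathcal F$ is the set of all $2d$ faces. For $f=\partial\omega_i^\pm$, $e_f^T$ restricts a grid vector to the grid points of $f$, and $H_f=H_{x_1}\otimes\cdots\otimes H_{x_{i-1}}\otimes H_{x_{i+1}}\otimes\cdots\otimes H_{x_d}$. Metric quantities. $F_{Ii}$ are the grid values of (a possibly approximate) transformation gradient $\partial x_i/\partial X_I$, invertible at each grid point; $\mathcal J=\det[(F^{-1})_{iI}]>0$ is the Jacobian determinant (written $\mathcal J$ to distinguish it from the index $J$); $\nu_i$ is the outward unit normal of $\omega$; $\hat J>0$ is the surface area scale factor; $n_I=\hat J^{-1}\mathcal JF_{Ii}\nu_i$ is the outward normal of $\Omega$. The quantities $\nu_i,n_I,\hat J$ are defined face by face: in any expression associated with the face $f$ they take the values belonging to $f$, also at edge and corner points. $D_I=F_{Ii}D_i$. Material. The real stiffness tensor satisfies, at each grid point, $C_{IJKL}=C_{KLIJ}$ and $S_{IJ}C_{IJKL}S_{KL}\ge0$ for all $S_{IJ}$. The transformed stiffness tensor is $c_{iJkL}=F_{Ii}\,\mathcal J\,C_{IJKL}F_{Kk}$.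 Define $$\mathbb D^\Omega_{IK}(C_{IJKL})=\mathcal J^{-1}\mathbb D_{ik}(c_{iJkL}),\qquad \mathbb T_{JL}=n_IC_{IJKL}D_K$$ ($\mathbb T_{JL}$ is the discrete traction operator). The Robin boundary condition is $n_IC_{IJKL}\partial_Ku_L+U_{JL}u_L=0$ on $\partial\Omega$, where the coefficient $U_{JL}$ satisfies $U_{JL}=U_{LJ}$ and $u_JU_{JL}u_L\ge0$ for all $u_J$; the displacement boundary condition is $u_J=0$ on $\partial\Omega$. Discrete integral. $(\mathbf u,\mathbf v)_\Omega=\mathbf u^T\mathcal JH\mathbf v$. *)

(* Defs.v *)
From HB Require Import structures.
From mathcomp Require Import all_boot all_order all_algebra.
From mathcomp Require Import reals.

Set Implicit Arguments.
Unset Strict Implicit.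
Unset Printing Implicit Defensive.

Import Order.TTheory GRing.Theory Num.Theory.
Local Open Scope ring_scope.

(* One-dimensional SBP operators on the grid 0, ..., N of [0, 1].  The norm
   matrix is diag(h_1, h_2, ..., h_2, h_1): [sbp_h] is palindromic.  The
   number of rows of each matrix 𝒟_(x^alpha) is left free. *)
Record sbp_operators (R : realType) (N : nat) := SbpOperators {
  sbp_h : 'rV[R]_N.+1;
  sbp_D : 'M[R]_N.+1;
  sbp_D2 : 'rV[R]_N.+1 -> 'M[R]_N.+1;
  sbp_nalpha : nat;
  sbp_rows : 'I_sbp_nalpha -> nat;
  sbp_Dalpha : forall alpha, 'M[R]_(sbp_rows alpha, N.+1);
  sbp_beta : forall alpha, 'I_(sbp_rows alpha) -> 'I_N.+1 -> R;
  sbp_H := diag_mx sbp_h;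
  sbp_e0 : 'cV[R]_N.+1 := delta_mx ord0 0;
  sbp_eN : 'cV[R]_N.+1 := delta_mx ord_max 0;
  sbp_B := fun alpha (b : 'rV[R]_N.+1) =>
    diag_mx (\row_r \sum_s sbp_beta (alpha := alpha) r s * b 0 s);
  sbp_R := fun b : 'rV[R]_N.+1 =>
    \sum_alpha (sbp_Dalpha alpha)^T *m sbp_B alpha b *m sbp_Dalpha alpha;
  sbp_h_gt0 : forall r, 0 < sbp_h 0 r;
  sbp_h_sym : forall r, sbp_h 0 (rev_ord r) = sbp_h 0 r;
  sbp_beta_ge0 : forall alpha (r : 'I_(sbp_rows alpha)) s,
    0 <= sbp_beta r s;
  sbp_D_spec :
    sbp_H *m sbp_D =
      - (sbp_D^T *m sbp_H) - sbp_e0 *m sbp_e0^T + sbp_eN *m sbp_eN^T;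
  sbp_D2_spec : forall b : 'rV[R]_N.+1,
    sbp_H *m sbp_D2 b =
      - (sbp_D^T *m sbp_H *m diag_mx b *m sbp_D) - sbp_R b
      - sbp_e0 *m sbp_e0^T *m diag_mx b *m sbp_D
      + sbp_eN *m sbp_eN^T *m diag_mx b *m sbp_D
}.

Definition grid (d N : nat) : finType := {ffun 'I_d -> 'I_N.+1}.

(* [(i, false)] is the face x_i = 0 and [(i, true)] the face x_i = 1. *)
Definition face (d : nat) : finType := ('I_d * bool)%type.

Definition on_face (d N : nat) (f : face d) (p : grid d N) : bool :=
  p f.1 == (if f.2 then ord_max else ord0).

Definition face_grid (d N : nat) (f : face d) : finType :=
  {p : grid d N | on_face f p}.

(* Grid vectors on a finite set T of grid points are column vectors of size
   #|T|, the coordinate a belonging to the point [enum_val a]. *)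
Definition fmx (R : realType) (S T : finType) (A : S -> T -> R) :
    'M[R]_(#|S|, #|T|) :=
  \matrix_(a, b) A (enum_val a) (enum_val b).

Definition coef (R : realType) (T : finType) (b : T -> R) : 'M[R]_#|T| :=
  diag_mx (\row_a b (enum_val a)).

(* A_1 ⊗ ... ⊗ A_d *)
Definition kron (R : realType) (d N : nat) (A : 'I_d -> 'M[R]_N.+1) :
    'M[R]_#|grid d N| :=
  fmx (fun p q : grid d N => \prod_j A j (p j) (q j)).

Definition set_coord (d N : nat) (i : 'I_d) (p : grid d N) (s : 'I_N.+1) :
    grid d N :=
  [ffun j => if j == i then s else p j].

Section Operators.
Context (R : realType) (d N : nat) (P : sbp_operators R N).

Definition D1 (i : 'I_d) : 'M[R]_#|grid d N| :=
  kron (fun j => if j == i then sbp_D P else 1%:M).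

Definition HH : 'M[R]_#|grid d N| := kron (fun=> sbp_H P).

Definition D2 (i : 'I_d) (b : grid d N -> R) : 'M[R]_#|grid d N| :=
  fmx (fun p q : grid d N =>
    if [forall j, (j != i) ==> (p j == q j)]
    then sbp_D2 P (\row_s b (set_coord i p s)) (p i) (q i)
    else 0).

Definition DD (i j : 'I_d) (b : grid d N -> R) : 'M[R]_#|grid d N| :=
  if i == j then D2 i b else D1 i *m coef b *m D1 j.

(* [(e_ f)^T] restricts a grid vector to the face f. *)
Definition e_ (f : face d) : 'M[R]_(#|grid d N|, #|face_grid N f|) :=
  fmx (fun (p : grid d N) (q : face_grid N f) => (p == val q)%:R).

Definition H_ (f : face d) : 'M[R]_#|face_grid N f| :=
  fmx (fun p q : face_grid N f =>
    \prod_(j | j != f.1) sbp_H P (val p j) (val q j)).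

Definition face_coef (f : face d) (b : grid d N -> R) :
    'M[R]_#|face_grid N f| :=
  coef (fun p : face_grid N f => b (val p)).

Definition nu (f : face d) (i : 'I_d) : R :=
  if i == f.1 then (if f.2 then 1 else -1) else 0.

(* F p I i approximates the derivative of x_i with respect to X_I at the grid
   point p.  Quantities attached to a face f are functions on the whole grid,
   but only their values at the points of f enter the SATs. *)
Context (F : grid d N -> 'M[R]_d) (Jhat : face d -> grid d N -> R)
        (C : grid d N -> 'I_d -> 'I_d -> 'I_d -> 'I_d -> R).

Definition Jac (p : grid d N) : R := \det (invmx (F p)).

Definition normal (f : face d) (I : 'I_d) (p : grid d N) : R :=
  (Jhat f p)^-1 * Jac p * \sum_i F p I i * nu f i.

Definition D1_phys (I : 'I_d) : 'M[R]_#|grid d N| :=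
  \sum_i coef (fun p => F p I i) *m D1 i.

Definition c_ref (i J k L : 'I_d) (p : grid d N) : R :=
  \sum_I \sum_K F p I i * Jac p * C p I J K L * F p K k.

Definition D_Omega (J L : 'I_d) : 'M[R]_#|grid d N| :=
  coef (fun p => (Jac p)^-1) *m \sum_i \sum_k DD i k (c_ref i J k L).

Definition traction (f : face d) (J L : 'I_d) : 'M[R]_#|grid d N| :=
  \sum_I \sum_K coef (fun p => normal f I p * C p I J K L) *m D1_phys K.

Definition SAT_robin (U : face d -> grid d N -> 'M[R]_d) (J L : 'I_d) :
    'M[R]_#|grid d N| :=
  - (invmx (coef Jac *m HH) *m
     \sum_f e_ f *m face_coef f (Jhat f) *m H_ f *m (e_ f)^T *m
       (traction f J L + coef (fun p => U f p J L))).

Definition Z_penalty (beta : R) (f : face d) (J L : 'I_d) :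
    'M[R]_#|grid d N| :=
  coef (fun p => beta * ((d%:R * Jhat f p) / (sbp_h P 0 ord0 * Jac p)) *
    \sum_I \sum_K normal f I p * C p I J K L * normal f K p).

Definition SAT_displacement (beta : R) (J L : 'I_d) : 'M[R]_#|grid d N| :=
  invmx (coef Jac *m HH) *m
  \sum_f (traction f L J - Z_penalty beta f L J)^T *m
    e_ f *m face_coef f (Jhat f) *m H_ f *m (e_ f)^T.

Definition D_tot (S : 'I_d -> 'I_d -> 'M[R]_#|grid d N|) (J L : 'I_d) :
    'M[R]_#|grid d N| :=
  D_Omega J L + S J L.

Definition inner_Omega (u v : 'cV[R]_#|grid d N|) : R :=
  (u^T *m coef Jac *m HH *m v) 0 0.

Definition self_adjoint (A : 'I_d -> 'I_d -> 'M[R]_#|grid d N|) : Prop :=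
  forall phi u : 'I_d -> 'cV[R]_#|grid d N|,
    \sum_J inner_Omega (phi J) (\sum_L A J L *m u L) =
    \sum_J inner_Omega (\sum_L A J L *m phi L) (u J).

End Operators.

(* Main.v *)
(* Weighting by M = 𝒥H turns self-adjointness into the block symmetry
   (M D_JL)^T = M D_LJ.  The SBP identities along each grid line give
   M D^Omega_JL = W_JL - A_JL, where the bulk part A_JL is block symmetric by
   the symmetry of C, and W_JL collects the boundary terms.  Since
   Ĵ n_I = 𝒥 F_Ii nu_i on each face, the face integrals of the tractions sum to
   exactly W_JL.  So the Robin SAT cancels W_JL and leaves the symmetric term
   in U, while the displacement SAT adds W_LJ^T, which makes W_JL + W_LJ^T
   block symmetric, and the symmetric term in Z. *)
Require Import Defs.
From HB Require Import structures.
From mathcomp Require Import all_boot all_order all_algebra.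
From mathcomp Require Import reals.
From mathcomp Require Import ring.

Set Implicit Arguments.
Unset Strict Implicit.
Unset Printing Implicit Defensive.

Import Order.TTheory GRing.Theory Num.Theory.
Local Open Scope ring_scope.

(** * Matrices indexed by finite sets of points, and diagonal coefficient matrices *)

Section GridMatrices.
Context (R : realType).

Lemma eq_fmx (S T : finType) (A B : S -> T -> R) :
  (forall x y, A x y = B x y) -> fmx A = fmx B.
Proof. by move=> eqAB; apply/matrixP=> a b; rewrite !mxE. Qed.

Lemma fmx_mul (S T V : finType) (A : S -> T -> R) (B : T -> V -> R) :
  fmx A *m fmx B = fmx (fun x z => \sum_y A x y * B y z).
Proof.
apply/matrixP=> a b; rewrite !mxE [RHS](reindex (enum_val : 'I_#|T| -> T)) /=.
  by apply: eq_bigr => k _; rewrite !mxE.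
exact/onW_bij/enum_val_bij.
Qed.

Lemma fmx_tr (S T : finType) (A : S -> T -> R) :
  (fmx A)^T = fmx (fun x y => A y x).
Proof. by apply/matrixP=> a b; rewrite !mxE. Qed.

Lemma coefE (T : finType) (b : T -> R) :
  coef b = fmx (fun x y => if x == y then b x else 0).
Proof.
apply/matrixP=> i j; rewrite !mxE (inj_eq enum_val_inj).
by case: eqP => [->|].
Qed.

Lemma eq_coef (T : finType) (a b : T -> R) : a =1 b -> coef a = coef b.
Proof. by move=> eqab; rewrite !coefE; apply: eq_fmx => x y; rewrite eqab. Qed.

Lemma coef_mul (T : finType) (a b : T -> R) :
  coef a *m coef b = coef (fun x => a x * b x).
Proof.
by apply/matrixP=> i j; rewrite mul_diag_mx !mxE; case: eqP => [->|];
  rewrite ?mulr1n ?mulr0n ?mulr0.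
Qed.

Lemma coef_sum (T I : finType) (b : I -> T -> R) :
  \sum_i coef (b i) = coef (fun x => \sum_i b i x).
Proof.
apply/matrixP=> i j; rewrite summxE !mxE -sumrMnl.
by apply: eq_bigr => k _; rewrite !mxE.
Qed.

Lemma coef_comm (T : finType) (a b : T -> R) :
  coef a *m coef b = coef b *m coef a.
Proof. by rewrite !coef_mul; apply: eq_coef => x; rewrite mulrC. Qed.

Lemma coef_tr (T : finType) (a : T -> R) : (coef a)^T = coef a.
Proof. exact: tr_diag_mx. Qed.

Lemma coef1 (T : finType) : coef (fun _ : T => 1 : R) = 1%:M.
Proof. by apply/matrixP=> i j; rewrite !mxE. Qed.

Lemma coef_unit (T : finType) (b : T -> R) :
  (forall x, b x != 0) -> coef b \in unitmx.
Proof.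
move=> b_neq0; have: coef b *m coef (fun x => (b x)^-1) = 1%:M.
  by rewrite coef_mul -coef1; apply: eq_coef => x; rewrite divff.
by case/mulmx1_unit.
Qed.

End GridMatrices.

(** * Operators acting along the grid lines of one direction *)

Section Lines.
Context (R : realType) (d N : nat) (i : 'I_d).
Local Notation grid := (grid d N).

(** The test is the one inside [D2], so that [D2_line] holds by conversion. *)
Definition same_line (p q : grid) : bool :=
  [forall j, (j != i) ==> (p j == q j)].

Lemma same_lineP (p q : grid) :
  reflect (q = set_coord i p (q i)) (same_line p q).
Proof.
apply: (iffP forallP) => [eqpq | -> j].
  apply/ffunP=> j; rewrite ffunE; case: eqP => [->//|/eqP ji].
  by have /implyP/(_ ji)/eqP := eqpq j.
by apply/implyP=> ji; rewrite ffunE (negPf ji).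
Qed.

Lemma set_coordE (p : grid) s : set_coord i p s i = s.
Proof. by rewrite ffunE eqxx. Qed.

Lemma set_coord_id (p : grid) : set_coord i p (p i) = p.
Proof. by apply/ffunP=> j; rewrite ffunE; case: eqP => [->|]. Qed.

Lemma set_coordK (p : grid) s t :
  set_coord i (set_coord i p s) t = set_coord i p t.
Proof. by apply/ffunP=> j; rewrite !ffunE; case: eqP. Qed.

Lemma same_line_set (p q : grid) s :
  same_line (set_coord i p s) q = same_line p q.
Proof. by apply/same_lineP/same_lineP; rewrite set_coordK. Qed.

Lemma same_lineC (p q : grid) : same_line p q = same_line q p.
Proof.
by apply/same_lineP/same_lineP => ->; rewrite set_coordK set_coord_id.
Qed.

Lemma eq_on_line (p q : grid) : (p == q) = same_line p q && (p i == q i).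
Proof.
apply/eqP/andP => [-> | [/same_lineP pq /eqP eqi]].
  by split=> //; apply/same_lineP; rewrite set_coord_id.
by rewrite pq -eqi set_coord_id.
Qed.

(** Such an [A] is really indexed by the lines in direction [i], each named by any of its points. *)
Definition line_const (X : Type) (A : grid -> X) : Prop :=
  forall p s, A (set_coord i p s) = A p.

(* The operator that applies [A p] along the grid line in direction i through
   p; this is meaningful for [line_const A]. *)
Definition line (A : grid -> 'M[R]_N.+1) : 'M[R]_#|grid| :=
  fmx (fun p q => if same_line p q then A p (p i) (q i) else 0).

Lemma eq_line (A B : grid -> 'M[R]_N.+1) : A =1 B -> line A = line B.
Proof. by move=> eqAB; apply: eq_fmx => p q; rewrite eqAB. Qed.

(** Only intermediate points [set_coord i p s] on the line through [p] contribute, and there [B] may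
    be evaluated at [p] instead. With [line_tr], this lifts one-dimensional matrix identities to the
    grid. *)
Lemma line_mul (A B : grid -> 'M[R]_N.+1) :
  line_const B -> line A *m line B = line (fun p => A p *m B p).
Proof.
move=> constB; rewrite fmx_mul; apply: eq_fmx => p r.
transitivity (\sum_s if same_line p r then A p (p i) s * B p s (r i) else 0).
  rewrite (bigID (same_line p)) /= [X in _ + X]big1 ?addr0; last first.
    by move=> q /negPf->; rewrite mul0r.
  rewrite (reindex_onto (set_coord i p) (fun q => q i)) /=; last first.
    by move=> q /same_lineP <-.
  apply: eq_big => [s | s _].
    rewrite set_coordE eqxx andbT; apply/same_lineP.
    by rewrite set_coordE.
  rewrite same_line_set same_lineC same_line_set constB set_coordE.
  rewrite (_ : same_line p p); last by apply/same_lineP; rewrite set_coord_id.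
  by case: ifP => // _; rewrite mulr0.
by case: ifP => _; rewrite ?mxE // big1.
Qed.

Lemma line_tr (A : grid -> 'M[R]_N.+1) :
  line_const A -> (line A)^T = line (fun p => (A p)^T).
Proof.
move=> constA; rewrite fmx_tr; apply: eq_fmx => p q; rewrite same_lineC mxE.
by case: ifP => // /same_lineP pq; rewrite pq constA -pq.
Qed.

Lemma lineD (A B : grid -> 'M[R]_N.+1) :
  line A + line B = line (fun p => A p + B p).
Proof.
by apply/matrixP=> a b; rewrite !mxE; case: ifP => _; rewrite ?mxE ?addr0.
Qed.

Lemma lineN (A : grid -> 'M[R]_N.+1) : - line A = line (fun p => - A p).
Proof.
by apply/matrixP=> a b; rewrite !mxE; case: ifP => _; rewrite ?mxE ?oppr0.
Qed.

Definition on_line (b : grid -> R) (p : grid) : 'rV[R]_N.+1 :=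
  \row_s b (set_coord i p s).

Lemma on_line_const b : line_const (on_line b).
Proof. by move=> p s; apply/rowP=> t; rewrite !mxE set_coordK. Qed.

Lemma coef_line (b : grid -> R) : coef b = line (fun p => diag_mx (on_line b p)).
Proof.
rewrite coefE; apply: eq_fmx => p q; rewrite eq_on_line !mxE.
case: (same_line p q) => //=; case: eqP => // _.
by rewrite set_coord_id.
Qed.

End Lines.

(** * Summation by parts on the tensor grid, and face quadratures *)

Section SBP.
Context (R : realType) (d N : nat) (P : sbp_operators R N).
Local Notation grid := (grid d N).
Local Notation HH := (HH d P).

(** These are the diagonal entries of [H_] on the faces normal to direction [i], extended constantly
    along that direction. *)
Definition transverse_weight (i : 'I_d) (p : grid) : R :=
  \prod_(j | j != i) sbp_h P 0 (p j).

Lemma transverse_weight_const i : line_const i (transverse_weight i).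
Proof.
by move=> p s; apply: eq_bigr => j ji; rewrite ffunE (negPf ji).
Qed.

Lemma HH_coef : HH = coef (fun p : grid => \prod_j sbp_h P 0 (p j)).
Proof.
rewrite coefE; apply: eq_fmx => p q; case: eqP => [<-|/eqP neqpq].
  by apply: eq_bigr => j _; rewrite !mxE eqxx.
(* Distinct points differ in some coordinate, whose diagonal factor makes the product vanish. *)
have [j pqj|eqpq] := pickP (fun j => p j != q j).
  by rewrite (bigD1 j) //= !mxE (negPf pqj) mul0r.
by case/eqP: neqpq; apply/ffunP=> j; apply/eqP/negbFE/eqpq.
Qed.

Lemma HH_line i : HH = line i (fun p => transverse_weight i p *: sbp_H P).
Proof.
rewrite HH_coef (coef_line i); apply: eq_line => p.
apply/matrixP=> s t; rewrite !mxE (bigD1 i) //= set_coordE mulrC -mulrnAr.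
congr (_ * _).
by rewrite -[RHS](transverse_weight_const i p s).
Qed.

Lemma HH_tr : HH^T = HH.
Proof. by rewrite HH_coef coef_tr. Qed.

(** The identity factors of the Kronecker product force agreement in every direction other than
    [i]. *)
Lemma D1_line (i : 'I_d) : D1 P i = line i (fun=> sbp_D P) :> 'M_#|grid|.
Proof.
apply: eq_fmx => p q; rewrite (bigD1 i) //= eqxx.
case: ifP => [/forallP eqpq | /negbT].
  rewrite big1 ?mulr1 // => j ji.
  by have /implyP/(_ ji) := eqpq j; rewrite (negPf ji) mxE => ->.
case/forallPn=> j; rewrite negb_imply => /andP[ji pqj].
by rewrite (bigD1 j) //= (negPf ji) mxE (negPf pqj) mul0r mulr0.
Qed.

Lemma D2_line (i : 'I_d) (b : grid -> R) :
  D2 P i b = line i (fun p => sbp_D2 P (on_line i b p)).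
Proof. by []. Qed.

(** Diagonal of the boundary term of summation by parts in direction [i]: the quadratures of the two
    faces normal to [i], signed by the outward normal. *)
Definition boundary_weight (i : 'I_d) (p : grid) : R :=
  transverse_weight i p * ((p i == ord_max)%:R - (p i == ord0)%:R).

Lemma boundary_weight_line i :
  coef (boundary_weight i) = line i (fun p => transverse_weight i p *:
     (sbp_eN P *m (sbp_eN P)^T - sbp_e0 P *m (sbp_e0 P)^T)).
Proof.
rewrite (coef_line i); apply: eq_line => p; apply/matrixP=> s t.
rewrite !mxE !big_ord1 !mxE /boundary_weight set_coordE transverse_weight_const.
have eqM m : (s == m)%:R *+ (s == t) = (s == m)%:R * (t == m)%:R :> R.
  by have [->|_] := eqVneq s m; rewrite ?mul1r ?mul0r ?mul0rn // eq_sym.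
by rewrite !andbT -mulrnAr mulrnBl !eqM.
Qed.

Lemma HH_D1 (i : 'I_d) :
  HH *m D1 P i = - ((D1 P i)^T *m HH) + coef (boundary_weight i).
Proof.
rewrite boundary_weight_line (HH_line i) D1_line line_tr // !line_mul //; last first.
  by move=> p s; rewrite transverse_weight_const.
rewrite lineN lineD; apply: eq_line => p.
rewrite -scalemxAl sbp_D_spec -scalemxAr -scalerN -scalerDr.
by rewrite -addrA [_ + sbp_eN _ *m _]addrC.
Qed.

Definition remainder (i : 'I_d) (b : grid -> R) : 'M[R]_#|grid| :=
  line i (fun p => transverse_weight i p *: sbp_R P (on_line i b p)).

(** Each summand is a congruence of the diagonal matrix [sbp_B]. *)
Lemma sbp_R_tr (b : 'rV[R]_N.+1) : (sbp_R P b)^T = sbp_R P b.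
Proof.
rewrite /sbp_R raddf_sum; apply: eq_bigr => alpha _ /=.
by rewrite !trmx_mul trmxK tr_diag_mx mulmxA.
Qed.

Lemma remainder_tr i b : (remainder i b)^T = remainder i b.
Proof.
rewrite line_tr => [|p s]; last by rewrite transverse_weight_const on_line_const.
by apply: eq_line => p; rewrite linearZ /= sbp_R_tr.
Qed.

Lemma eq_remainder i a b : a =1 b -> remainder i a = remainder i b.
Proof.
move=> eqab; apply: eq_line => p; congr (_ *: sbp_R P _).
by apply/rowP=> s; rewrite !mxE eqab.
Qed.

Lemma HH_D2 i (b : grid -> R) :
  HH *m D2 P i b = - ((D1 P i)^T *m HH *m coef b *m D1 P i)
    - remainder i b + coef (boundary_weight i) *m coef b *m D1 P i.
Proof.
have constw := @transverse_weight_const i.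
have constb := @on_line_const R d N i b.
rewrite boundary_weight_line (coef_line i) (HH_line i) D1_line line_tr // D2_line.
rewrite !line_mul //; try by [move=> p s; rewrite ?constw ?constb].
rewrite lineN /remainder lineN !lineD; apply: eq_line => p.
rewrite -scalemxAl sbp_D2_spec -!scalemxAr -!scalemxAl -!scalerN -!scalerDr.
by congr (_ *: _); rewrite -addrA !mulmxBl [- _ + sbp_eN _ *m _ *m _ *m _]addrC.
Qed.

(** Full compatibility: the same [D1] appears in the second-derivative identity, so pure and mixed
    derivatives differ only by the symmetric remainder. *)
Lemma HH_DD i k (b : grid -> R) :
  HH *m DD P i k b = - ((D1 P i)^T *m HH *m coef b *m D1 P k)
    - (if i == k then remainder i b else 0)
    + coef (boundary_weight i) *m coef b *m D1 P k.
Proof.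
rewrite /DD; case: eqP => [<-|_]; first exact: HH_D2.
by rewrite !mulmxA HH_D1 !mulmxDl !mulNmx subr0.
Qed.

(** The face quadrature weighted by [g], extended by zero to the whole grid, so that face terms can
    be compared with volume terms. *)
Definition face_weight (f : face d) (g : grid -> R) (p : grid) : R :=
  if on_face f p then g p * transverse_weight f.1 p else 0.

Lemma H_coef (f : face d) :
  H_ P f = coef (fun p : face_grid N f => transverse_weight f.1 (val p)).
Proof.
rewrite coefE; apply: eq_fmx => p q; case: eqP => [<-|/eqP neqpq].
  by apply: eq_bigr => j _; rewrite !mxE eqxx.
(* Points of [f] share the coordinate [f.1], so distinct ones must differ in a transverse
   coordinate. *)
have: ~~ same_line f.1 (val p) (val q).
  apply: contra neqpq => pq; rewrite -val_eqE /= (eq_on_line f.1) pq /=.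
  by rewrite (eqP (valP p)) (eqP (valP q)).
case/forallPn=> j; rewrite negb_imply => /andP[ji pqj].
by rewrite (bigD1 j) //= !mxE (negPf pqj) mul0r.
Qed.

Lemma face_sandwich (f : face d) (g : grid -> R) :
  e_ R N f *m face_coef f g *m H_ P f *m (e_ R N f)^T = coef (face_weight f g).
Proof.
rewrite H_coef -(mulmxA (e_ R N f)) coef_mul !coefE fmx_tr !fmx_mul.
apply: eq_fmx => p q; rewrite /face_weight.
under eq_bigr => y _.
  rewrite (bigD1 y) //= eqxx big1 ?addr0; last first.
    by move=> x /negPf->; rewrite mulr0.
  over.
have [fp|nfp] := boolP (on_face f p).
  rewrite (bigD1 (exist _ p fp)) //= eqxx mul1r big1 ?addr0; last first.
    move=> y; rewrite -val_eqE /= eq_sym => /negPf->.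
    by rewrite !mul0r.
  by rewrite eq_sym; case: eqP; rewrite ?mulr1 ?mulr0.
rewrite big1 ?if_same // => y _; case: eqP => [py|]; last by rewrite !mul0r.
by rewrite py (valP y) in nfp.
Qed.

End SBP.

(** * Block symmetry of the elastic operator weighted by the mass matrix *)

Section Elastic.
Context (R : realType) (d N : nat) (P : sbp_operators R N).
Context (F : grid d N -> 'M[R]_d) (Jhat : face d -> grid d N -> R)
        (C : grid d N -> 'I_d -> 'I_d -> 'I_d -> 'I_d -> R).
Local Notation grid := (grid d N).
Local Notation HH := (HH d P).
Local Notation D1 := (D1 P).
Local Notation D_tot := (D_tot P F C).

Lemma self_adjoint_of_sym (A : 'I_d -> 'I_d -> 'M[R]_#|grid|) :
  (forall J L, (coef (Jac F) *m HH *m A J L)^T = coef (Jac F) *m HH *m A L J) ->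
  self_adjoint P F A.
Proof.
have massT : (coef (Jac F) *m HH)^T = coef (Jac F) *m HH.
  by rewrite trmx_mul coef_tr HH_tr HH_coef coef_comm.
move=> symA phi u; pose M := coef (Jac F) *m HH.
transitivity (\sum_J \sum_L ((phi J)^T *m (M *m A J L) *m u L) 0 0).
  apply: eq_bigr => J _; rewrite /inner_Omega mulmx_sumr summxE.
  by apply: eq_bigr => L _; rewrite !mulmxA.
rewrite exchange_big; apply: eq_bigr => J _.
rewrite /inner_Omega raddf_sum -!mulmxA mulmx_suml summxE.
apply: eq_bigr => L _ /=; rewrite -symA trmx_mul massT.
by rewrite trmx_mul !mulmxA.
Qed.

Hypothesis C_sym : forall p I J K L, C p I J K L = C p K L I J.

Lemma c_ref_sym i J k L p : c_ref F C i J k L p = c_ref F C k L i J p.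
Proof.
rewrite /c_ref exchange_big; apply: eq_bigr => K _; apply: eq_bigr => I _.
by rewrite C_sym; ring.
Qed.

(** The boundary part W_JL of the overview. *)
Definition boundary_flux (J L : 'I_d) : 'M[R]_#|grid| :=
  \sum_i \sum_k coef (boundary_weight P i) *m coef (c_ref F C i J k L) *m D1 k.

(** The part A_JL of the overview; remainders arise only for equal derivative directions. *)
Definition bulk (J L : 'I_d) : 'M[R]_#|grid| :=
  (\sum_i \sum_k (D1 i)^T *m HH *m coef (c_ref F C i J k L) *m D1 k)
  + \sum_i remainder P i (c_ref F C i J i L).

(** Transposition swaps the directions [i] and [k], and [c_ref_sym] swaps them back together with
    [J] and [L]. *)
Lemma bulk_tr J L : (bulk J L)^T = bulk L J.
Proof.
rewrite raddfD /= !raddf_sum /=; congr (_ + _); last first.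
  apply: eq_bigr => i _; rewrite remainder_tr.
  by apply: eq_remainder => p; rewrite c_ref_sym.
under eq_bigr do rewrite raddf_sum /=.
rewrite exchange_big; apply: eq_bigr => k _; apply: eq_bigr => i _ /=.
rewrite !trmx_mul trmxK coef_tr HH_tr HH_coef -!mulmxA; congr (_ *m _).
rewrite !mulmxA coef_comm; congr (_ *m _ *m _).
by apply: eq_coef => p; rewrite c_ref_sym.
Qed.

Hypothesis Jac_gt0 : forall p, 0 < Jac F p.

Lemma mass_D_Omega J L :
  coef (Jac F) *m HH *m D_Omega P F C J L = boundary_flux J L - bulk J L.
Proof.
have -> : coef (Jac F) *m HH *m D_Omega P F C J L
    = \sum_i \sum_k HH *m DD P i k (c_ref F C i J k L).
  have JacV : coef (Jac F) *m coef (fun p => (Jac F p)^-1) = 1%:M.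
    by rewrite coef_mul -coef1; apply: eq_coef => p; rewrite divff ?gt_eqF.
  rewrite /D_Omega HH_coef coef_comm -!mulmxA (mulmxA (coef (Jac F))) JacV mul1mx.
  by rewrite mulmx_sumr; apply: eq_bigr => i _; rewrite mulmx_sumr.
rewrite /boundary_flux /bulk opprD addrA -!sumrN -!big_split /=.
apply: eq_bigr => i _.
under eq_bigr do rewrite HH_DD.
rewrite big_split /= addrC big_split /= -addrA sumrN; congr (_ + (_ + _)).
by rewrite sumrN (bigD1 i) //= eqxx big1 ?addr0 // => k; rewrite eq_sym => /negPf->.
Qed.

Lemma mass_unit : coef (Jac F) *m HH \in unitmx.
Proof.
rewrite HH_coef coef_mul coef_unit // => p; apply/lt0r_neq0/mulr_gt0 => //.
by apply: prodr_gt0 => j _; apply: sbp_h_gt0.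
Qed.

(** * Face integrals of the tractions and the two kinds of SATs *)

Hypothesis Jhat_gt0 : forall f p, on_face f p -> 0 < Jhat f p.

(** The area factor cancels the inverse one in [normal]; what remains of the contraction with [C]
    and both transformation gradients is [c_ref]. *)
Lemma face_traction f J L :
  coef (face_weight P f (Jhat f)) *m traction P F Jhat C f J L
  = \sum_k coef (face_weight P f (fun=> nu R f f.1)) *m
      coef (c_ref F C f.1 J k L) *m D1 k.
Proof.
rewrite /traction /D1_phys.
transitivity (\sum_I \sum_K \sum_k coef (fun p => face_weight P f (Jhat f) p *
    (normal F Jhat f I p * C p I J K L * F p K k)) *m D1 k).
  rewrite mulmx_sumr; apply: eq_bigr => I _.
  rewrite mulmx_sumr; apply: eq_bigr => K _.
  rewrite !mulmx_sumr; apply: eq_bigr => k _.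
  by rewrite !mulmxA !coef_mul; congr (_ *m _); apply: eq_coef => p; rewrite !mulrA.
under eq_bigr do rewrite exchange_big /=.
rewrite exchange_big; apply: eq_bigr => k _ /=.
under eq_bigr do rewrite -mulmx_suml coef_sum.
rewrite -mulmx_suml coef_sum coef_mul; congr (_ *m _); apply: eq_coef => p.
rewrite /face_weight; case: ifPn => [fp|_]; last first.
  by rewrite mul0r big1 // => I _; rewrite big1 // => K _; rewrite mul0r.
rewrite /c_ref mulr_sumr; apply: eq_bigr => I _.
rewrite mulr_sumr; apply: eq_bigr => K _.
(* The reference normal is an axis vector, so only the direction [f.1] survives. *)
rewrite /normal (bigD1 f.1) //= [X in _ + X]big1 ?addr0; last first.
  by move=> i /negPf ni; rewrite /nu ni mulr0.
by field; rewrite gt_eqF ?Jhat_gt0.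
Qed.

(** The two opposite faces of each direction, with normals 1 and -1, add up to [boundary_weight]. *)
Lemma sum_face_traction J L :
  \sum_f coef (face_weight P f (Jhat f)) *m traction P F Jhat C f J L
  = boundary_flux J L.
Proof.
under eq_bigr do rewrite face_traction.
rewrite -(pair_bigA _ (fun i b => \sum_k
  coef (face_weight P (i, b) (fun=> nu R (i, b) i)) *m
  coef (c_ref F C i J k L) *m D1 k)) /=.
apply: eq_bigr => i _; rewrite exchange_big; apply: eq_bigr => k _ /=.
rewrite -!mulmx_suml coef_sum; congr (_ *m _ *m _); apply: eq_coef => p.
rewrite big_bool /face_weight /boundary_weight /on_face /nu /= eqxx.
by do 2!case: eqP => _ /=; ring.
Qed.

Lemma mass_SAT_robin U J L :
  coef (Jac F) *m HH *m SAT_robin P F Jhat C U J L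
  = - boundary_flux J L
    - \sum_f coef (fun p => face_weight P f (Jhat f) p * U f p J L).
Proof.
rewrite /SAT_robin mulmxN (mulKVmx mass_unit) -opprD; congr (- _).
rewrite -sum_face_traction -big_split; apply: eq_bigr => f _ /=.
by rewrite face_sandwich mulmxDr coef_mul.
Qed.

(** Face weights are diagonal, so a transposed traction times a weight is the transpose of the
    weighted traction; summing over faces gives the transposed flux. *)
Lemma mass_SAT_displacement beta J L :
  coef (Jac F) *m HH *m SAT_displacement P F Jhat C beta J L
  = (boundary_flux L J)^T
    - \sum_f coef (face_weight P f (Jhat f)) *m Z_penalty P F Jhat C beta f L J.
Proof.
rewrite /SAT_displacement (mulKVmx mass_unit) -sum_face_traction raddf_sum.
rewrite -sumrN -big_split; apply: eq_bigr => f _ /=.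
rewrite -!mulmxA (mulmxA (e_ R N f)) (mulmxA (_ *m face_coef _ _)) face_sandwich.
rewrite raddfB /= mulmxBl trmx_mul !coef_tr; congr (_ - _).
exact: coef_comm.
Qed.

Lemma Z_penalty_sym beta f J L :
  Z_penalty P F Jhat C beta f J L = Z_penalty P F Jhat C beta f L J.
Proof.
apply: eq_coef => p; congr (_ * _).
rewrite exchange_big; apply: eq_bigr => K _; apply: eq_bigr => I _.
by rewrite C_sym; ring.
Qed.

Lemma robin_self_adjoint (U : face d -> grid -> 'M[R]_d) :
  (forall f p, on_face f p -> forall J L, U f p J L = U f p L J) ->
  self_adjoint P F (D_tot (SAT_robin P F Jhat C U)).
Proof.
move=> U_sym; apply: self_adjoint_of_sym => J L.
have massD J' L' : coef (Jac F) *m HH *m D_tot (SAT_robin P F Jhat C U) J' L'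
    = - bulk J' L'
      - \sum_f coef (fun p => face_weight P f (Jhat f) p * U f p J' L').
  by rewrite mulmxDr mass_D_Omega mass_SAT_robin addrACA subrr add0r.
rewrite !massD linearB linearN /= bulk_tr linear_sum /=; congr (_ - _).
apply: eq_bigr => f _; rewrite coef_tr; apply: eq_coef => p.
(* Off the face the weight is zero, so symmetry of [U] at the face points suffices. *)
by rewrite /face_weight; case: ifP => [fp|_]; rewrite ?mul0r // (U_sym f p fp).
Qed.

Lemma displacement_self_adjoint beta :
  self_adjoint P F (D_tot (SAT_displacement P F Jhat C beta)).
Proof.
apply: self_adjoint_of_sym => J L.
have massD J' L' :
    coef (Jac F) *m HH *m D_tot (SAT_displacement P F Jhat C beta) J' L'
    = boundary_flux J' L' - bulk J' L' + ((boundary_flux L' J')^T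
      - \sum_f coef (face_weight P f (Jhat f)) *m
          Z_penalty P F Jhat C beta f L' J').
  by rewrite mulmxDr mass_D_Omega mass_SAT_displacement.
(* Grouping the two flux terms together exposes a sum that transposition merely reorders. *)
rewrite (massD J L) (massD L J) linearD 2!linearB /= trmxK bulk_tr addrACA [RHS]addrACA.
rewrite [_ + boundary_flux _ _]addrC; congr (_ + (_ - _)).
rewrite linear_sum; apply: eq_bigr => f _ /=.
by rewrite Z_penalty_sym trmx_mul !coef_tr; exact: coef_comm.
Qed.

End Elastic.

Theorem theorem3 (R : realType) (d N : nat) (N_gt0 : (0 < N)%N)
    (P : sbp_operators R N)
    (F : grid d N -> 'M[R]_d)
    (F_unit : forall p, F p \in unitmx)
    (Jac_gt0 : forall p, 0 < Jac F p)
    (Jhat : face d -> grid d N -> R)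
    (Jhat_gt0 : forall f p, on_face f p -> 0 < Jhat f p)
    (C : grid d N -> 'I_d -> 'I_d -> 'I_d -> 'I_d -> R)
    (C_sym : forall p I J K L, C p I J K L = C p K L I J)
    (C_ge0 : forall p (S : 'M[R]_d),
      0 <= \sum_I \sum_J \sum_K \sum_L S I J * C p I J K L * S K L) :
  (forall U : face d -> grid d N -> 'M[R]_d,
     (forall f p, on_face f p -> forall J L, U f p J L = U f p L J) ->
     (forall f p, on_face f p -> forall u : 'I_d -> R,
        0 <= \sum_J \sum_L u J * U f p J L * u L) ->
     self_adjoint P F (D_tot P F C (SAT_robin P F Jhat C U)))
  /\
  (forall beta : R, 1 <= beta ->
     self_adjoint P F (D_tot P F C (SAT_displacement P F Jhat C beta))).
Proof.
split=> [U U_sym _ | beta _].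
  exact: robin_self_adjoint.
exact: displacement_self_adjoint.
Qed.
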